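(* Let $G$ be a free abelian group and let $T\subseteq G$ be a generating subset of $G$ such that $0\in T$ and $2g-t\in T$ for all $g\in G$ and $t\in T$. Let $\mathcal{U}$ be the group with presentation $$\mathcal{U}=\big\langle (t^{\mathcal U})_{t\in T}\;\big|\;(t^{\mathcal U})^2=1,\ t^{\mathcal U}s^{\mathcal U}(t^{\mathcal U})^{-1}=(2t-s)^{\mathcal U}\text{ for all } s,t\in T\big\rangle,$$ and let $\mathcal{W}$ (the Weyl group) be the subgroup generated by $\{(0,t,-1)\mid t\in T\}$ of the group $(G\wedge G)\times G\times\{1,-1\}$ with multiplication $(l,g,v)(l',g',v')=(l+l'+g\wedge(vg'),\,g+vg',\,vv')$. Let $\mathcal U\to\mathcal W$ be the group homomorphism determined by $t^{\mathcal U}\mapsto(0,t,-1)$ for $t\in T$. Let $G_2=G/2G$ and let $T^{\mathrm{ab}}$ be the image of $T$ under the quotient map $G\to G_2$. Then $\mathcal U\to\mathcal W$ is an isomorphism if and only if $T^{\mathrm{ab}}\setminus\{0\}$ is $2$-independent in $G_2$.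
   Context: $G\wedge G$ is the exterior square of $G$. $G_2=G/2G$ is regarded as a vector space over $\mathbb{F}_2$. A subset $M$ of $G_2$ is called 2-dependent if the elements of the set $\{g\otimes g\mid g\in M\}$ are linearly dependent over $\mathbb{F}_2$ in $G_2\otimes G_2$, and 2-independent if it is not 2-dependent. The homomorphism $\mathcal U\to\mathcal W$ exists because the elements $(0,t,-1)$ satisfy the defining relations of $\mathcal U$. *)

(* Defs.v *)
From HB Require Import structures.
From mathcomp Require Import all_boot all_order all_algebra.
Set Implicit Arguments. Unset Strict Implicit. Unset Printing Implicit Defensive.
Import GRing.Theory.
Local Open Scope ring_scope.

Definition additive_map (M N : zmodType) (h : M -> N) : Prop :=
  forall x y, h (x + y) = h x + h y.

Definition biadditive (M N : zmodType) (f : M -> M -> N) : Prop :=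
  (forall x y z, f (x + y) z = f x z + f y z) /\
  (forall x y z, f x (y + z) = f x y + f x z).

Definition alternating (M N : zmodType) (f : M -> M -> N) : Prop :=
  forall x, f x x = 0.

Definition is_exterior_square (G A : zmodType) (w : G -> G -> A) : Prop :=
  [/\ biadditive w, alternating w &
      forall (B : zmodType) (f : G -> G -> B), biadditive f -> alternating f ->
        (exists h : A -> B, additive_map h /\ forall x y, h (w x y) = f x y) /\
        (forall h1 h2 : A -> B, additive_map h1 -> additive_map h2 ->
           (forall x y, h1 (w x y) = f x y) -> (forall x y, h2 (w x y) = f x y) ->
           forall a, h1 a = h2 a)].

Definition is_tensor_square (V TT : zmodType) (t : V -> V -> TT) : Prop :=
  biadditive t /\
  forall (B : zmodType) (f : V -> V -> B), biadditive f ->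
    (exists h : TT -> B, additive_map h /\ forall x y, h (t x y) = f x y) /\
    (forall h1 h2 : TT -> B, additive_map h1 -> additive_map h2 ->
       (forall x y, h1 (t x y) = f x y) -> (forall x y, h2 (t x y) = f x y) ->
       forall a, h1 a = h2 a).

Definition is_free_abelian (G : zmodType) : Prop :=
  exists (I : eqType) (b : I -> G),
    (forall g : G, exists s : seq (I * int), g = \sum_(p <- s) b p.1 *~ p.2) /\
    (forall (s : seq I) (c : I -> int), uniq s ->
       \sum_(i <- s) b i *~ c i = 0 -> forall i, i \in s -> c i = 0).

Definition generates (G : zmodType) (T : G -> Prop) : Prop :=
  forall g : G, exists s : seq (G * int),
    (forall p, p \in s -> T p.1) /\ g = \sum_(p <- s) p.1 *~ p.2.

Definition is_quotient_by_2 (G G2 : zmodType) (pi : G -> G2) : Prop :=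
  [/\ additive_map pi, (forall y : G2, exists g, pi g = y) &
      forall g, pi g = 0 <-> exists h, g = h *+ 2].

(** The group (G /\ G) x G x {1,-1}, with elements encoded as triples
    (l, g, v) in A * G * int (only v = 1 or v = -1 occur in W). *)
Definition mulW (G A : zmodType) (w : G -> G -> A) (x y : A * G * int)
  : A * G * int :=
  let '(l, g, v) := x in let '(l', g', v') := y in
  (l + l' + w g (g' *~ v), g + g' *~ v, v * v').

Definition oneW (G A : zmodType) : A * G * int := (0, 0, 1).

Definition invW (G A : zmodType) (x : A * G * int) : A * G * int :=
  let '(l, g, v) := x in (- l, - (g *~ v), v).

Definition genW (G A : zmodType) (t : G) : A * G * int := (0, t, -1).

Inductive inW (G A : zmodType) (w : G -> G -> A) (T : G -> Prop)
  : A * G * int -> Prop :=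
| inW_gen t : T t -> inW w T (genW A t)
| inW_one : inW w T (oneW G A)
| inW_mul x y : inW w T x -> inW w T y -> inW w T (mulW w x y)
| inW_inv x : inW w T x -> inW w T (invW x).

(** Words in the free group on T: letters (t, b), b = true meaning t^{-1}. *)
Definition letter (G : zmodType) (T : G -> Prop) := ({t : G | T t} * bool)%type.

Inductive Ueq (G : zmodType) (T : G -> Prop)
  : seq (letter T) -> seq (letter T) -> Prop :=
| Ueq_refl u : Ueq u u
| Ueq_sym u v : Ueq u v -> Ueq v u
| Ueq_trans u v x : Ueq u v -> Ueq v x -> Ueq u x
| Ueq_cat u u' v v' : Ueq u u' -> Ueq v v' -> Ueq (u ++ v) (u' ++ v')
| Ueq_free x b : Ueq [:: (x, b); (x, ~~ b)] [::]
| Ueq_sq x : Ueq [:: (x, false); (x, false)] [::]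
| Ueq_conj t s r : sval r = sval t *+ 2 - sval s ->
    Ueq [:: (t, false); (s, false); (t, true)] [:: (r, false)].

Definition evalW (G A : zmodType) (w : G -> G -> A) (T : G -> Prop)
  (u : seq (letter T)) : A * G * int :=
  foldr (fun p acc =>
           mulW w (if p.2 then invW (genW A (sval p.1)) else genW A (sval p.1)) acc)
        (oneW G A) u.

Definition U_to_W_iso (G A : zmodType) (w : G -> G -> A) (T : G -> Prop) : Prop :=
  (forall x, inW w T x -> exists u : seq (letter T), evalW w u = x) /\
  (forall u v : seq (letter T), evalW w u = evalW w v -> Ueq u v).

(** M in G2 is 2-dependent: the set {g (x) g | g in M} is linearly dependent
    over F_2, i.e. some nonempty finite set of its (distinct) elements sums to 0. *)
Definition two_dependent (V TT : zmodType) (tens : V -> V -> TT) (M : V -> Prop)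
  : Prop :=
  exists s : seq TT,
    [/\ s != [::], uniq s,
        (forall z, z \in s -> exists g, M g /\ z = tens g g) &
        \sum_(z <- s) z = 0].

Definition two_independent (V TT : zmodType) (tens : V -> V -> TT) (M : V -> Prop)
  : Prop := ~ two_dependent tens M.

Definition Tab_nonzero (G G2 : zmodType) (T : G -> Prop) (pi : G -> G2)
  : G2 -> Prop :=
  fun x => (exists t, T t /\ pi t = x) /\ x <> 0.

(* Main.v *)
Require Import Defs.
From HB Require Import structures.
From mathcomp Require Import all_boot all_order all_algebra.
From mathcomp Require Import generic_quotient boolp ring zify.
Import GRing.Theory.
Local Open Scope ring_scope.

Set Implicit Arguments.
Unset Strict Implicit.
Unset Printing Implicit Defensive.

(** An element x of U with image (l, g, v) in W conjugates the generator s to the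
    generator 2g + vs.  Hence the elements with image (l, 0, 1) are central, and
    the commutators of elements with v = 1 define an alternating biadditive map
    on G; their products embed into W because G /\ G is torsion-free.

    Collecting equal classes modulo 2 by means of these conjugations, a word in
    which every class of G/2G occurs an even number of times becomes a product of
    commutators and of one element (2g)(0), so it is trivial as soon as its image
    in W is.  On the other hand (l, g, v) |-> theta l + g (x) g, where theta maps
    x /\ y to x (x) y + y (x) x, is a homomorphism from W to the tensor square of
    G/2G; so a word in the kernel of U -> W gives a relation between the squares
    t (x) t of its letters, and 2-independence forces all multiplicities to be even.

    Conversely, the parity of the number of letters in a given class is an invariant
    of U.  If the squares of distinct nonzero classes add up to 0, then suitable
    lifts t_1, ..., t_n of these classes and of 0 add up to 0, and the sum of the
    t_i /\ t_j with i < j is twice an element of G /\ G.  The product of the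
    (t_i)(0) corrected by commutators lies in the kernel but has an odd parity. *)

(** * Additive, biadditive and alternating maps of abelian groups *)

Section AdditiveMaps.
Variables (M N : zmodType).

Lemma additive_map0 (h : M -> N) : additive_map h -> h 0 = 0.
Proof. by move=> hD; apply: (addIr (h 0)); rewrite -hD !add0r. Qed.

Lemma additive_mapN (h : M -> N) : additive_map h -> {morph h : x / - x}.
Proof.
move=> hD x; apply: (addIr (h x)).
by rewrite -hD !addNr additive_map0.
Qed.

Lemma additive_map_sum (h : M -> N) : additive_map h ->
  forall (I : Type) (s : seq I) (F : I -> M),
    h (\sum_(i <- s) F i) = \sum_(i <- s) h (F i).
Proof.
move=> hD I s F; elim: s => [|i s IHs]; first by rewrite !big_nil additive_map0.
by rewrite !big_cons hD IHs.
Qed.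

Lemma additive_mapMz (h : M -> N) : additive_map h ->
  forall (n : int) x, h (x *~ n) = h x *~ n.
Proof.
move=> hD n x.
have hMn (m : nat) : h (x *+ m) = h x *+ m.
  by elim: m => [|m IHm]; rewrite ?mulr0n ?additive_map0 // !mulrS hD IHm.
case: n => n; first by rewrite -!pmulrn.
by rewrite NegzE !mulrNz additive_mapN // -!pmulrn hMn.
Qed.

Variables (f : M -> M -> N).
Hypothesis fD : biadditive f.

Lemma biadditive_l y : additive_map (f^~ y).
Proof. by case: fD => fDl _ x x'; apply: fDl. Qed.

Lemma biadditive_r x : additive_map (f x).
Proof. by case: fD => _ fDr y y'; apply: fDr. Qed.

Lemma alternatingN : alternating f -> forall x y, f y x = - f x y.
Proof.
case: (fD) => fDl fDr f0 x y; apply/eqP; rewrite -addr_eq0; apply/eqP.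
by have := f0 (x + y); rewrite fDl !fDr !f0 add0r addr0 addrC.
Qed.

End AdditiveMaps.

(** * Coordinates of a free abelian group *)

Section Coordinates.
Variables (G : zmodType) (I : eqType) (b : I -> G).
Hypothesis b_gen : forall g : G, exists s : seq (I * int),
  g = \sum_(p <- s) b p.1 *~ p.2.
Hypothesis b_free : forall (s : seq I) (c : I -> int), uniq s ->
  \sum_(i <- s) b i *~ c i = 0 -> forall i, i \in s -> c i = 0.

Definition expands (g : G) (s : seq I) (c : I -> int) : Prop :=
  [/\ uniq s, forall i, i \notin s -> c i = 0 & g = \sum_(i <- s) b i *~ c i].

Lemma big_supp (s1 s2 : seq I) (c : I -> int) : uniq s1 -> uniq s2 ->
  {subset s1 <= s2} -> (forall i, i \notin s1 -> c i = 0) ->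
  \sum_(i <- s2) b i *~ c i = \sum_(i <- s1) b i *~ c i.
Proof.
move=> u1 u2 s12 c0; rewrite (bigID (mem s1)) /= [X in _ + X]big1 ?addr0.
  rewrite -big_filter; apply: perm_big; apply: uniq_perm => //.
    by rewrite filter_uniq.
  by move=> i; rewrite mem_filter; case: (boolP (i \in s1)) => // /s12 ->.
by move=> i /c0 ->; rewrite mulr0z.
Qed.

Lemma expands_sub g s1 s2 c :
  expands g s1 c -> uniq s2 -> {subset s1 <= s2} -> expands g s2 c.
Proof.
move=> [u1 c0 ->] u2 s12; split=> //; last by rewrite (big_supp u1).
by move=> i /(contraNN (s12 i))/c0.
Qed.

Lemma expandsD g h s1 s2 c d : expands g s1 c -> expands h s2 d ->
  expands (g + h) (undup (s1 ++ s2)) (fun i => c i + d i).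
Proof.
move=> gc hd; have us := undup_uniq (s1 ++ s2).
have [|_ c0 ->] := expands_sub gc us.
  by move=> i i1; rewrite mem_undup mem_cat i1.
have [|_ d0 ->] := expands_sub hd us.
  by move=> i i2; rewrite mem_undup mem_cat i2 orbT.
split=> // [i i_notin|]; first by rewrite c0 ?d0.
by rewrite -big_split; apply: eq_bigr => i _; rewrite mulrzDr.
Qed.

Lemma expandsN g s c : expands g s c -> expands (- g) s (fun i => - c i).
Proof.
move=> [us c0 ->]; split=> // [i /c0 ->|]; first by rewrite oppr0.
by rewrite -sumrN; apply: eq_bigr => i _; rewrite mulrNz.
Qed.

Lemma expands_ex g : exists c, exists s, expands g s c.
Proof.
have [l ->] := b_gen g; elim: l => [|[i n] l [c [s cs]]].
  by exists (fun=> 0), [::]; rewrite big_nil; split=> //; rewrite big_nil.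
rewrite big_cons /=; have ce: expands (b i *~ n) [:: i] (fun j => if j == i then n else 0).
  split=> // [j|]; first by rewrite inE => /negPf->.
  by rewrite big_seq1 eqxx.
by eexists; eexists; exact: expandsD ce cs.
Qed.

(** The difference of the two expansions expands 0: freeness kills its coefficients on the support,
    and off the support they vanish by definition. *)
Lemma expands_uniq g s1 s2 c d : expands g s1 c -> expands g s2 d -> c =1 d.
Proof.
move=> gc gd; have := expandsD gc (expandsN gd); rewrite subrr.
set s := undup _ => -[us cd0 /esym/(b_free us) e0] i; apply/eqP.
by rewrite -subr_eq0; apply/eqP; case: (boolP (i \in s)) => [/e0|/cd0].
Qed.

Definition coord (i : I) (g : G) : int := sval (cid (expands_ex g)) i.

Lemma coordP g : exists s, expands g s (coord^~ g).
Proof. by rewrite /coord; case: (cid _). Qed.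

Lemma coordD i : additive_map (coord i).
Proof.
move=> g h; have [s1 g1] := coordP g; have [s2 h2] := coordP h.
have [s gh] := coordP (g + h).
exact: expands_uniq gh (expandsD g1 h2) i.
Qed.

Lemma coord_support (L : seq G) :
  exists s, forall g, g \in L -> expands g s (coord^~ g).
Proof.
elim: L => [|g L [s IHs]]; first by exists [::].
have [s' gs'] := coordP g; exists (undup (s' ++ s)) => h.
rewrite inE => /orP[/eqP->|/IHs hs]; [apply: expands_sub gs' _ _|apply: expands_sub hs _ _];
  by rewrite ?undup_uniq // => i i_s; rewrite mem_undup mem_cat i_s ?orbT.
Qed.

(** The 2 by 2 minors of the coordinates of [x] and [y]; by the universal property they become
    functionals on the exterior square. *)
Definition minor (p : I * I) (x y : G) : int :=
  coord p.1 x * coord p.2 y - coord p.2 x * coord p.1 y.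

Lemma minor_biadditive p : biadditive (minor p).
Proof. by split=> x y z; rewrite /minor !coordD; ring. Qed.

Lemma minor_alternating p : alternating (minor p).
Proof. by move=> x; rewrite /minor; ring. Qed.

(** Pairs are ordered by position in the list, since [I] carries no order. *)
Fixpoint upairs (s : seq I) : seq (I * I) :=
  if s is i :: s' then [seq (i, j) | j <- s'] ++ upairs s' else [::].

Lemma alternating_sum_expand (N : zmodType) (f : G -> G -> N) (s : seq I)
    (c d : I -> int) : biadditive f -> alternating f ->
  f (\sum_(i <- s) b i *~ c i) (\sum_(i <- s) b i *~ d i) =
  \sum_(p <- upairs s) f (b p.1) (b p.2) *~ (c p.1 * d p.2 - c p.2 * d p.1).
Proof.
move=> fD f0; have fl := biadditive_l fD; have fr := biadditive_r fD.
elim: s => [|i s IHs]; first by rewrite !big_nil (additive_map0 (fr _)).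
rewrite !big_cons /= big_cat big_map /= -IHs fl !fr !(additive_mapMz (fl _)).
rewrite !(additive_mapMz (fr _)) f0 !mul0rz add0r addrA; congr (_ + _).
rewrite (additive_map_sum (fr _)) (additive_map_sum (fl _)) !mulrz_suml.
rewrite -big_split /=; apply: eq_bigr => j _.
rewrite (additive_mapMz (fl _)) !(additive_mapMz (fr _)) (alternatingN fD f0 (b i)).
by rewrite mulNrz mulNrz -!mulrzA -mulrzBr; congr (_ *~ _); ring.
Qed.

(** Every entry of [L] is expanded over one common finite support. The coefficients are sums of
    minors and do not depend on [f], so what [w] reveals about them applies to [comm] as well. *)
Lemma alternating_expand (L : seq (G * G)) : exists ps : seq (I * I),
  forall (N : zmodType) (f : G -> G -> N), biadditive f -> alternating f ->
  \sum_(xy <- L) f xy.1 xy.2 =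
  \sum_(p <- ps) f (b p.1) (b p.2) *~ (\sum_(xy <- L) minor p xy.1 xy.2).
Proof.
have [s sP] := coord_support ([seq xy.1 | xy <- L] ++ [seq xy.2 | xy <- L]).
exists (upairs s) => N f fD f0.
under [RHS]eq_bigr do rewrite mulrz_sumr.
rewrite exchange_big /=; apply: eq_big_seq => -[x y] xyL /=.
have [|_ _ xE] := sP x; first by rewrite mem_cat (map_f _ xyL).
have [|_ _ yE] := sP y; first by rewrite mem_cat (map_f _ xyL) orbT.
by rewrite {1}xE {1}yE alternating_sum_expand.
Qed.

Definition coord2 (i : I) (g : G) : 'F_2 := (coord i g)%:~R.

Lemma coord2D i : additive_map (coord2 i).
Proof. by move=> g h; rewrite /coord2 coordD rmorphD. Qed.

Lemma F2_double (x : 'F_2) : x *+ 2 = 0.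
Proof. by rewrite -mulr_natl [2%:R](_ : _ = 0) ?mul0r //; apply: val_inj. Qed.

Lemma intF2_eq0 (n : int) : n%:~R = 0 :> 'F_2 -> exists m, n = m *+ 2.
Proof.
rewrite {1}(divz_eq n 2) => n0; exists (n %/ 2)%Z.
rewrite {1}(divz_eq n 2); have : (n %% 2)%Z \in [:: 0; 1] by rewrite !inE; lia.
rewrite !inE => /orP[]/eqP nE; first by rewrite nE; lia.
have two0 : 2%:~R = 0 :> 'F_2 by apply: val_inj.
by move: n0; rewrite nE rmorphD rmorphM /= two0 mulr0 add0r => /eqP.
Qed.

Lemma coord2_eq0 g : (forall i, coord2 i g = 0) -> exists h, g = h *+ 2.
Proof.
move=> g0; have [s [_ _ ->]] := coordP g.
elim: s => [|i s [h IHs]]; first by exists 0; rewrite big_nil mul0rn.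
have [m iE] := intF2_eq0 (g0 i).
exists (b i *~ m + h); rewrite big_cons IHs iE mulrnDl; congr (_ + _).
by rewrite !pmulrn -!mulrzA; congr (_ *~ _); lia.
Qed.

End Coordinates.

(** * The tensor square of G/2G and its elements [tens x x] *)

Section SquareTensors.
Variables (G G2 TT : zmodType) (pi : G -> G2) (tens : G2 -> G2 -> TT).
Hypothesis piP : is_quotient_by_2 pi.
Hypothesis tensP : is_tensor_square tens.

Lemma quotient_additive : additive_map pi.
Proof. by case: piP. Qed.

Lemma quotient_double (x : G2) : x *+ 2 = 0.
Proof.
have [piD pi_onto pi0] := piP; have [g <-] := pi_onto x.
by rewrite mulr2n -piD; apply/pi0; exists g; rewrite mulr2n.
Qed.

Lemma quotient_eq g h : pi g = pi h <-> exists k, g = h + k *+ 2.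
Proof.
have [piD _ pi0] := piP; split=> [gh | [k ->]].
  have /pi0[k kE] : pi (g - h) = 0 by rewrite piD (additive_mapN piD) gh subrr.
  by exists k; rewrite -kE addrC subrK.
by rewrite piD [pi (k *+ 2)](pi0 _).2 ?addr0 //; exists k.
Qed.

Lemma quotient_eq0 g : pi g = 0 <-> exists h, g = h *+ 2.
Proof. by case: piP. Qed.

Lemma tens_double x y : tens x y *+ 2 = 0.
Proof.
have [tD _] := tensP.
rewrite mulr2n -(biadditive_l tD) -mulr2n quotient_double.
exact: additive_map0 (biadditive_l tD y).
Qed.

Variables (I : eqType) (b : I -> G).
Hypothesis b_gen : forall g : G, exists s : seq (I * int),
  g = \sum_(p <- s) b p.1 *~ p.2.
Hypothesis b_free : forall (s : seq I) (c : I -> int), uniq s ->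
  \sum_(i <- s) b i *~ c i = 0 -> forall i, i \in s -> c i = 0.
Local Notation coord2 := (coord2 b_gen).

Lemma coord2_quotient i g h : pi g = pi h -> coord2 i g = coord2 i h.
Proof.
move/quotient_eq => [k ->]; have cD := coord2D b_gen b_free i.
by rewrite mulr2n !cD -mulr2n F2_double addr0.
Qed.

(** Coordinate functionals on the tensor square, used to read off relations between squares. *)
Lemma tens_coord2 i j : exists2 h : TT -> 'F_2, additive_map h &
  forall x y, h (tens (pi x) (pi y)) = coord2 i x * coord2 j y.
Proof.
have [piD pi_onto _] := piP.
(* As [coord2] depends only on the class modulo 2, any set-theoretic section of [pi] makes [f]
   biadditive. *)
have piV x : exists g, pi g == x by have [g <-] := pi_onto x; exists g.
pose lift x := xchoose (piV x).
have liftK x : pi (lift x) = x by exact/eqP/(xchooseP (piV x)).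
pose f x y := coord2 i (lift x) * coord2 j (lift y).
have liftD k x y : coord2 k (lift (x + y)) = coord2 k (lift x) + coord2 k (lift y).
  by rewrite -(coord2D b_gen b_free); apply: coord2_quotient; rewrite piD !liftK.
have fD : biadditive f.
  by split=> x y z; rewrite /f liftD ?mulrDl ?mulrDr.
have [[h [hD hE]] _] := tensP.2 _ f fD; exists h => // x y.
by rewrite hE /f; congr (_ * _); apply: coord2_quotient; rewrite liftK.
Qed.

Lemma sum_square_coord2 (ts : seq G) i j :
  \sum_(t <- ts) tens (pi t) (pi t) = 0 ->
  \sum_(t <- ts) coord2 i t * coord2 j t = 0.
Proof.
have [h hD hE] := tens_coord2 i j; move/(congr1 h).
rewrite (additive_map0 hD) (additive_map_sum hD) => h0.
by rewrite -[RHS]h0; apply: eq_bigr => t _; rewrite hE.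
Qed.

Lemma F2_square (x : 'F_2) : x * x = x.
Proof. by apply/eqP; case: x => [[|[|]]]. Qed.

(** The diagonal functional for [i] takes the value [coord2 i t] squared, which over the field of
    two elements is [coord2 i t] itself. So the diagonal of the sum of squares records the sum of
    the classes. *)
Lemma sum_square_quotient (ts : seq G) :
  \sum_(t <- ts) tens (pi t) (pi t) = 0 -> pi (\sum_(t <- ts) t) = 0.
Proof.
have [_ _ pi0] := piP; move=> ts0; apply/pi0/(coord2_eq0 (b_gen := b_gen)) => i.
rewrite -[RHS](sum_square_coord2 i i ts0) (additive_map_sum (coord2D b_gen b_free i)).
by apply: eq_bigr => t _; rewrite F2_square.
Qed.

(** Equal squares add up to 0, so the classes add up to 0 and agree. This lets multiplicities of
    squares stand for multiplicities of classes. *)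
Lemma tens_square_inj : injective (fun x => tens x x).
Proof.
have [piD pi_onto _] := piP; move=> x y /=.
have [g <-] := pi_onto x; have [h <-] := pi_onto y => gh.
have := @sum_square_quotient [:: g; h].
rewrite !big_cons !big_nil !addr0 gh -mulr2n tens_double piD => /(_ erefl) gh0.
by apply: (addIr (pi h)); rewrite gh0 -mulr2n quotient_double.
Qed.

End SquareTensors.

(** * Parity of multiplicities in a list *)

Section Multiplicities.
Variable V : zmodType.
Implicit Types zs : seq V.

(** In exponent 2 only odd multiplicities survive. The remaining terms are distinct and nonzero, as
    a witness of 2-dependence must be. *)
Lemma sum_odd_mult zs : {in zs, forall z, z *+ 2 = 0} ->
  \sum_(z <- zs) z = \sum_(z <- undup zs | odd (count_mem z zs) && (z != 0)) z.
Proof.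
move=> zs2; rewrite -big_undup_iterop_count [RHS]big_mkcond /=.
apply: eq_big_seq => z; rewrite mem_undup => /zs2 z2.
rewrite -/(z *+ count_mem z zs) -{1}(odd_double_half (count_mem z zs)).
rewrite mulrnDr -mul2n mulrnA z2 mul0rn addr0 mulrb.
by case: eqVneq => [->|_]; rewrite ?andbT ?if_same // andbF if_same.
Qed.

Lemma even_size zs : (forall z, ~~ odd (count_mem z zs)) -> ~~ odd (size zs).
Proof.
move=> ev_zs; rewrite -sum1_size -big_undup_iterop_count.
elim/big_ind: _ => // [m n|z _]; first by rewrite oddD => /negPf-> /negPf->.
suff -> : iterop (count_mem z zs) addn 1%N 0%N = count_mem z zs by [].
by case: (count _ zs) => // n; elim: n => //= n ->.
Qed.

(** A sum does not see how often 0 occurs; this parity is the total length minus the length of the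
    nonzero part, which is even by [even_size]. *)
Lemma even_mult0 zs : ~~ odd (size zs) ->
  (forall z, z != 0 -> ~~ odd (count_mem z zs)) -> forall z, ~~ odd (count_mem z zs).
Proof.
move=> ev_size ev_zs z; have [->|/ev_zs//] := eqVneq z 0.
have := @even_size [seq y <- zs | y != 0]; rewrite size_filter => ev_nz.
move: ev_size; rewrite -(count_predC (pred1 0)) oddD (negPf (ev_nz _)) ?addbF // => y.
rewrite count_filter; have [->|y0] := eqVneq y 0.
  by rewrite (eq_count (a2 := pred0)) ?count_pred0 // => u /=; case: eqP.
have /eq_count -> : predI (pred1 y) (fun u => u != 0) =1 pred1 y.
  by move=> u /=; case: eqVneq => // ->; rewrite y0.
exact: ev_zs.
Qed.

End Multiplicities.

(** * The group U *)

Section PresentedGroup.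
Variables (G : zmodType) (T : G -> Prop).
Local Open Scope quotient_scope.

(** The [classic] wrapper gives letters the choice structure that the quotient type requires. *)
Definition word := seq {classic letter T}.

Definition word_eq : rel word := fun u v => `[< @Ueq G T u v >].

Lemma word_eqP u v : reflect (@Ueq G T u v) (word_eq u v).
Proof. exact: asboolP. Qed.

Lemma word_eq_refl : reflexive word_eq.
Proof. by move=> u; apply/word_eqP/Ueq_refl. Qed.

Lemma word_eq_sym : symmetric word_eq.
Proof. by move=> u v; apply/idP/idP => /word_eqP uv; apply/word_eqP/Ueq_sym. Qed.

Lemma word_eq_trans : transitive word_eq.
Proof. by move=> v u x /word_eqP uv /word_eqP vx; apply/word_eqP/(Ueq_trans uv). Qed.

Canonical word_equiv := EquivRel word_eq word_eq_refl word_eq_sym word_eq_trans.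

Definition U := {eq_quot word_eq}.
HB.instance Definition _ := Choice.on U.

Definition Ucl (u : word) : U := \pi_U u.

Lemma UclP u v : Ucl u = Ucl v <-> Ueq u v.
Proof. by split=> [/eqmodP/word_eqP|/word_eqP/eqmodP]. Qed.

Lemma Ucl_surj x : exists u, x = Ucl u.
Proof. by exists (repr x); rewrite /Ucl reprK. Qed.

Lemma Ueq_repr u : Ueq (repr (Ucl u)) u.
Proof. by apply/UclP; rewrite /Ucl reprK. Qed.

Definition word_inv (u : word) : word := rev [seq (l.1, ~~ l.2) | l <- u].

Lemma word_inv_l u : Ueq (word_inv u ++ u) [::].
Proof.
elim: u => [|[x c] u IHu]; first exact: Ueq_refl.
rewrite /word_inv /= rev_cons -cats1 -catA.
apply: Ueq_trans IHu; apply: Ueq_cat; first exact: Ueq_refl.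
apply: (@Ueq_cat _ _ [:: (x, ~~ c); (x, c)] [::]); last exact: Ueq_refl.
by have := Ueq_free x (~~ c); rewrite negbK.
Qed.

Lemma word_invK : involutive word_inv.
Proof.
move=> u; rewrite /word_inv map_rev revK -map_comp -[RHS]map_id.
by apply: eq_map => -[x c] /=; rewrite negbK.
Qed.

Lemma word_inv_r u : Ueq (u ++ word_inv u) [::].
Proof. by have := word_inv_l (word_inv u); rewrite word_invK. Qed.

Lemma word_inv_eq u v : Ueq u v -> Ueq (word_inv u) (word_inv v).
Proof.
move=> uv; apply: Ueq_trans (_ : Ueq _ (word_inv u ++ (v ++ word_inv v))) _.
  rewrite -[X in Ueq X _]cats0; apply: Ueq_cat; first exact: Ueq_refl.
  exact/Ueq_sym/word_inv_r.
rewrite catA -[X in Ueq _ X]cat0s; apply: Ueq_cat; last exact: Ueq_refl.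
apply: Ueq_trans (word_inv_l u); apply: Ueq_cat; first exact: Ueq_refl.
exact: Ueq_sym.
Qed.

Definition Umul (x y : U) : U := Ucl (repr x ++ repr y).
Definition Uinv (x : U) : U := Ucl (word_inv (repr x)).

Lemma Umul_cat u v : Umul (Ucl u) (Ucl v) = Ucl (u ++ v).
Proof. by apply/UclP/Ueq_cat; apply: Ueq_repr. Qed.

Lemma Uinv_word u : Uinv (Ucl u) = Ucl (word_inv u).
Proof. by apply/UclP/word_inv_eq/Ueq_repr. Qed.

Lemma UmulA : associative Umul.
Proof.
move=> x y z; have [u ->] := Ucl_surj x; have [v ->] := Ucl_surj y.
by have [t ->] := Ucl_surj z; rewrite !Umul_cat catA.
Qed.

Lemma Umul1l : left_id (Ucl [::]) Umul.
Proof. by move=> x; have [u ->] := Ucl_surj x; rewrite Umul_cat. Qed.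

Lemma Umul1r : right_id (Ucl [::]) Umul.
Proof. by move=> x; have [u ->] := Ucl_surj x; rewrite Umul_cat cats0. Qed.

Lemma UmulVl : left_inverse (Ucl [::]) Uinv Umul.
Proof.
move=> x; have [u ->] := Ucl_surj x.
by rewrite Uinv_word Umul_cat; apply/UclP/word_inv_l.
Qed.

Lemma UmulVr : right_inverse (Ucl [::]) Uinv Umul.
Proof.
move=> x; have [u ->] := Ucl_surj x.
by rewrite Uinv_word Umul_cat; apply/UclP/word_inv_r.
Qed.

HB.instance Definition _ := isGroup.Build U UmulA Umul1l Umul1r UmulVl UmulVr.

Local Open Scope group_scope.

Lemma Ucl_cat u v : Ucl (u ++ v) = Ucl u * Ucl v.
Proof. by rewrite -Umul_cat. Qed.

(** Extended by 1 outside [T], so that generators are indexed by elements of [G] without membership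
    proofs. *)
Definition gen (t : G) : U :=
  if pselect (T t) is left Tt then Ucl [:: (exist _ t Tt, false)] else 1.

Lemma gen_sval (x : {t | T t}) : gen (sval x) = Ucl [:: (x, false)].
Proof.
case: x => t Tt; rewrite /gen /=; case: (pselect (T t)) => // Tt'.
by rewrite (Prop_irrelevance Tt' Tt).
Qed.

Lemma genM t : T t -> gen t * gen t = 1.
Proof.
by move=> Tt; rewrite (gen_sval (exist _ t Tt)) -Ucl_cat; apply/UclP/Ueq_sq.
Qed.

Lemma genV t : T t -> (gen t)^-1 = gen t.
Proof. by move/genM/mulg1_eq. Qed.

(** Generators are involutions, so the inversion flag of a letter is irrelevant in the group. *)
Lemma gen_letter (x : {t | T t}) c : Ucl [:: (x, c)] = gen (sval x).
Proof.
case: c; last by rewrite gen_sval.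
rewrite -(genV (svalP x)) gen_sval; apply/esym/mulg1_eq.
by rewrite -Ucl_cat; apply/UclP/Ueq_free.
Qed.

Lemma gen_conj t s : T t -> T s -> T (t *+ 2 - s)%R ->
  gen t * gen s * (gen t)^-1 = gen (t *+ 2 - s)%R.
Proof.
move=> Tt Ts Tr; rewrite genV // (gen_sval (exist _ s Ts)) (gen_sval (exist _ _ Tr)).
rewrite {1}(gen_sval (exist _ t Tt)) -(gen_letter (exist _ t Tt) true) -!Ucl_cat.
exact/UclP/Ueq_conj.
Qed.

Lemma Ucl_prod (u : word) : Ucl u = \prod_(l <- u) gen (sval l.1).
Proof.
elim: u => [|[x c] u IHu]; first by rewrite big_nil.
by rewrite big_cons -IHu -(gen_letter x c) -Ucl_cat.
Qed.

Lemma U_ind (P : U -> Prop) : P 1 ->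
  (forall t x, T t -> P x -> P (gen t * x)) -> forall x, P x.
Proof.
move=> P1 Pgen x; have [u ->] := Ucl_surj x; rewrite Ucl_prod.
elim: u => [|[y c] u IHu]; first by rewrite big_nil.
by rewrite big_cons; apply: Pgen => //; apply: svalP.
Qed.

Lemma U_generated x : exists2 ts : seq G, {in ts, forall t, T t} &
  x = \prod_(t <- ts) gen t.
Proof.
move: x; apply: U_ind => [|t x Tt [ts Tts ->]].
  by exists [::]; rewrite ?big_nil.
exists (t :: ts); last by rewrite big_cons.
by move=> s; rewrite inE => /orP[/eqP->|/Tts].
Qed.

End PresentedGroup.

(** * The homomorphism from U to W *)

Section CentralCommutators.
Variable gT : groupType.
Local Open Scope group_scope.
Implicit Types x y z : gT.

Lemma commMg_central x z y : (forall u, commute [~ x, y] u) ->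
  [~ x * z, y] = [~ x, y] * [~ z, y].
Proof.
move=> cxy; rewrite (commgEl (x * z)) (commgEl z) conjMg invgM -mulgA.
by rewrite (mulgA x^-1) -(commgEl x) (mulgA z^-1) -cxy -mulgA.
Qed.

Lemma commg_centrall x z y : (forall u, commute z u) -> [~ x * z, y] = [~ x, y].
Proof.
move=> cz; rewrite !commgEl conjMg invgM.
have -> : z ^ y = z by rewrite conjgE cz mulKg.
by rewrite -mulgA [x^-1 * _]mulgA -cz mulKg.
Qed.

End CentralCommutators.

(** * Evaluation of words in W *)

Section Evaluation.
Variables (G A : zmodType) (T : G -> Prop) (w : G -> G -> A).
Hypothesis wD : biadditive w.
Hypothesis w0 : alternating w.

Local Notation "x *W y" := (mulW w x y) (at level 40, left associativity).

(** The sign component ranges over all integers in this encoding; the hypothesis removes the factor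
    v^2 from the wedge of [g' *~ v] with [g'' *~ (v * v')]. *)
Lemma mulWA (x y z : A * G * int) : x.2 * x.2 = 1 -> x *W (y *W z) = x *W y *W z.
Proof.
case: x => [[l g] v]; case: y => [[l' g'] v']; case: z => [[l'' g''] v''] /= vv.
have wl := biadditive_l wD; have wr := biadditive_r wD.
congr (_, _, _); last by rewrite mulrA.
  rewrite mulrzDl wl wr.
  have -> : w (g' *~ v) (g'' *~ (v * v')) = w g' (g'' *~ v').
    rewrite mulrC mulrzA (additive_mapMz (wl _)) (additive_mapMz (wr _)).
    by rewrite -mulrzA vv mulr1z.
  rewrite mulrC mulrzA -!addrA; do 2!congr (_ + _).
  by rewrite (addrCA (w g' _)) (addrCA l'') (addrC (w g' _)).
by rewrite mulrzDl addrA mulrC mulrzA.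
Qed.

Lemma mul1W x : oneW G A *W x = x.
Proof.
case: x => [[l g] v]; rewrite /mulW /oneW mul1r !add0r mulr1z.
by rewrite (additive_map0 (biadditive_l wD _)) addr0.
Qed.

Lemma mulW1 x : x *W oneW G A = x.
Proof.
case: x => [[l g] v]; rewrite /mulW /oneW mulr1 mul0rz !addr0.
by rewrite (additive_map0 (biadditive_r wD _)) addr0.
Qed.

Lemma invW_gen (t : G) : invW (genW A t) = genW A t.
Proof. by rewrite /invW /genW oppr0 mulrN1z opprK. Qed.

Lemma evalW_cons (l : letter T) u :
  evalW w (l :: u) = genW A (sval l.1) *W evalW w u.
Proof.
case: l => x c.
rewrite -[LHS]/((if c then invW (genW A (sval x)) else genW A (sval x)) *W evalW w u).
by rewrite invW_gen if_same.
Qed.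

Lemma evalW_cat (u v : seq (letter T)) : evalW w (u ++ v) = evalW w u *W evalW w v.
Proof.
elim: u => [|l u IHu]; first by rewrite mul1W.
by rewrite cat_cons !evalW_cons IHu mulWA.
Qed.

Lemma genWK t : genW A t *W genW A t = oneW G A.
Proof.
by rewrite /genW /mulW /oneW mulrN1z subrr !add0r (additive_mapN (biadditive_r wD _)) w0 oppr0.
Qed.

Lemma genW_conj t s : genW A t *W (genW A s *W genW A t) = genW A (t *+ 2 - s).
Proof.
have wl := biadditive_l wD; have wr := biadditive_r wD.
rewrite /genW /mulW !mulrN1z; congr (_, _, _).
  rewrite !add0r opprB (additive_mapN (wr _)) !wr (additive_mapN (wr _)) w0.
  by rewrite add0r (alternatingN wD w0 t s) opprK subrr.
by rewrite opprB addrA mulr2n.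
Qed.

Lemma evalW_Ueq (u v : seq (letter T)) : Ueq u v -> evalW w u = evalW w v.
Proof.
elim=> {u v} [//|u v _ ->//|u v x _ -> _ ->//|u u' v v' _ uu' _ vv'|x c|x|t s r rE].
- by rewrite !evalW_cat uu' vv'.
- by rewrite !evalW_cons mulW1 genWK.
- by rewrite !evalW_cons mulW1 genWK.
- by rewrite !evalW_cons !mulW1 genW_conj rE.
Qed.

Lemma evalW_sgn (u : seq (letter T)) : (evalW w u).2 * (evalW w u).2 = 1.
Proof.
elim: u => [//|l u]; rewrite evalW_cons.
by case: (evalW w u) => [[a g] v] /= vv; rewrite mulN1r mulrNN.
Qed.

(** Each letter evaluates to an involution whatever its flag, so reversing a word already inverts
    its value. *)
Lemma evalW_rev (u : seq (letter T)) : evalW w (rev u) = invW (evalW w u).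
Proof.
elim: u => [|l u IHu]; first by rewrite /= /oneW mul0rz !oppr0.
rewrite rev_cons -cats1 evalW_cat IHu !evalW_cons mulW1; have := evalW_sgn u.
have wr := biadditive_r wD; have wl := biadditive_l wD.
case: (evalW w u) => [[a g] v] /= vv; rewrite /genW /mulW /invW.
congr (_, _, _); last by rewrite mulrC.
  rewrite add0r addr0 (additive_mapN (wl _)) mulrN1z (additive_mapN (wr _)).
  rewrite (additive_mapMz (wl _)) (additive_mapMz (wr _)) -mulrzA vv mulr1z.
  by rewrite opprD opprK (alternatingN wD w0 g).
by rewrite mulrN1z mulN1r mulrNz opprK mulrzBl addrC.
Qed.

Lemma inW_evalW x : inW w T x -> exists u : seq (letter T), evalW w u = x.
Proof.
elim=> {x} [t Tt||x y _ [u <-] _ [v <-]|x _ [u <-]].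
- by exists [:: (exist _ t Tt, false)]; rewrite evalW_cons mulW1.
- by exists [::].
- by exists (u ++ v); rewrite evalW_cat.
- by exists (rev u); rewrite evalW_rev.
Qed.

End Evaluation.

(** * Position and sign of elements of U, and their action on the generators *)

Section Structure.
Variables (G A : zmodType) (T : G -> Prop) (w : G -> G -> A).
Hypothesis wD : biadditive w.
Hypothesis w0 : alternating w.
Hypothesis T0 : T 0.
Hypothesis T_refl : forall g t, T t -> T (g *+ 2 - t).
Hypothesis T_gen : generates T.
Local Notation U := (U T).
Local Notation gen := (@gen G T).
Local Open Scope group_scope.
Implicit Types (x y z : U) (g h t s : G).

Definition ev x : A * G * int := evalW w (repr x : seq (letter T)).
Definition pos x : G := (ev x).1.2.
Definition sgn x : int := (ev x).2.

Lemma ev_word (u : word T) : ev (Ucl u) = evalW w (u : seq (letter T)).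
Proof. exact/(evalW_Ueq wD w0)/Ueq_repr. Qed.

Lemma ev1 : ev 1 = oneW G A.
Proof. exact: ev_word. Qed.

Lemma evM x y : ev (x * y) = mulW w (ev x) (ev y).
Proof.
have [u ->] := Ucl_surj x; have [v ->] := Ucl_surj y.
by rewrite -Ucl_cat !ev_word evalW_cat.
Qed.

Lemma ev_gen t : T t -> ev (gen t) = genW A t.
Proof.
by move=> Tt; rewrite (gen_sval (exist _ t Tt)) ev_word evalW_cons // mulW1.
Qed.

Lemma pos1 : pos 1 = 0. Proof. by rewrite /pos ev1. Qed.
Lemma sgn1 : sgn 1 = 1%R. Proof. by rewrite /sgn ev1. Qed.

Lemma posM x y : pos (x * y) = pos x + pos y *~ sgn x.
Proof. by rewrite /pos /sgn evM; case: (ev x) (ev y) => [[? ?] ?] [[]]. Qed.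

Lemma sgnM x y : sgn (x * y) = (sgn x * sgn y)%R.
Proof. by rewrite /sgn evM; case: (ev x) (ev y) => [[? ?] ?] [[]]. Qed.

Lemma pos_gen t : T t -> pos (gen t) = t.
Proof. by move=> Tt; rewrite /pos ev_gen. Qed.

Lemma sgn_gen t : T t -> sgn (gen t) = (-1)%R.
Proof. by move=> Tt; rewrite /sgn ev_gen. Qed.

Lemma sgnP x : sgn x = 1%R \/ sgn x = (-1)%R.
Proof.
elim/U_ind: x => [|t x Tt]; first by rewrite sgn1; left.
by rewrite sgnM sgn_gen // mulN1r => -[] ->; [right|left; rewrite opprK].
Qed.

Lemma sgnV x : sgn x^-1 = sgn x.
Proof.
have := sgnM x x^-1; rewrite mulgV sgn1.
by case: (sgnP x) (sgnP x^-1) => [] -> [] ->.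
Qed.

Lemma posV x : sgn x = 1%R -> pos x^-1 = - pos x.
Proof.
move=> x1; apply/eqP; rewrite -addr_eq0 addrC.
by rewrite -[pos x^-1]mulr1z -x1 -posM mulgV pos1.
Qed.

(** Each generator acts by a reflection s -> 2t - s. These compose to affine maps whose translation
    and slope are given by [pos x] and [sgn x]. Membership in [T] is carried along because
    [gen_conj] asks for it. *)
Lemma gen_conjU x s : T s ->
  T (pos x *+ 2 + s *~ sgn x) /\ x * gen s * x^-1 = gen (pos x *+ 2 + s *~ sgn x).
Proof.
move=> Ts; elim/U_ind: x => [|t x Tt [Tx IHx]].
  by rewrite pos1 sgn1 mul0rn add0r mulr1z mul1g invg1 mulg1.
have -> : pos (gen t * x) *+ 2 + s *~ sgn (gen t * x) =
    t *+ 2 - (pos x *+ 2 + s *~ sgn x).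
  rewrite posM sgnM pos_gen // sgn_gen // mulrN1z mulN1r mulrNz mulrnDl mulNrn.
  by rewrite -addrA -opprD.
have Tr := T_refl t Tx; split=> //.
by rewrite -gen_conj // -IHx invgM !mulgA.
Qed.

(* The kernel of the conjugation action of U on its generators. *)
Definition flat : {pred U} := fun x => (pos x == 0) && (sgn x == 1%R).

Lemma flatP x : reflect (pos x = 0 /\ sgn x = 1%R) (x \in flat).
Proof. by apply: (iffP andP) => -[/eqP ? /eqP ?]. Qed.

Lemma flat_central x y : x \in flat -> commute x y.
Proof.
move=> /flatP[x0 x1]; elim/U_ind: y => [|t y Tt cxy]; first exact: commute1.
apply: commuteM cxy; have [_] := gen_conjU x Tt.
rewrite x0 x1 mul0rn add0r mulr1z => xE.
by rewrite /commute -{2}xE mulgVK.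
Qed.

(** * The central subgroup of flat elements, written additively *)

Lemma flat1 : 1 \in flat. Proof. by apply/flatP; rewrite pos1 sgn1. Qed.

Lemma flatM x y : x \in flat -> y \in flat -> x * y \in flat.
Proof.
move=> /flatP[x0 x1] /flatP[y0 y1]; apply/flatP.
by rewrite posM sgnM x0 x1 y0 y1 mulr1 addr0.
Qed.

Lemma flatV x : x \in flat -> x^-1 \in flat.
Proof.
by move=> /flatP[x0 x1]; apply/flatP; rewrite sgnV posV // x0 oppr0.
Qed.

(** As a [zmodType], this central subgroup can be the target of alternating maps on [G]. *)
Definition flatU := {x : U | x \in flat}.
HB.instance Definition _ := Choice.on flatU.
HB.instance Definition _ := SubType.on flatU.

Definition in_flat x (xf : x \in flat) : flatU := exist (fun y => y \in flat) x xf.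

Definition flat_add (x y : flatU) : flatU := in_flat (flatM (valP x) (valP y)).
Definition flat_opp (x : flatU) : flatU := in_flat (flatV (valP x)).
Definition flat_zero : flatU := in_flat flat1.

Lemma flat_addA : associative flat_add.
Proof. by move=> x y z; apply: val_inj; rewrite /= mulgA. Qed.
Lemma flat_addC : commutative flat_add.
Proof. by move=> x y; apply: val_inj; exact: flat_central (valP x). Qed.
Lemma flat_add0 : left_id flat_zero flat_add.
Proof. by move=> x; apply: val_inj; rewrite /= mul1g. Qed.
Lemma flat_addN : left_inverse flat_zero flat_opp flat_add.
Proof. by move=> x; apply: val_inj; rewrite /= mulVg. Qed.

HB.instance Definition _ :=
  GRing.isZmodule.Build flatU flat_addA flat_addC flat_add0 flat_addN.

Lemma flat_valD (x y : flatU) : val (x + y)%R = val x * val y.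
Proof. by []. Qed.

(** * Commutators of elements of sign 1 as an alternating map on G *)

Definition wgt x : A := (ev x).1.1.

Lemma wgtM x y : sgn x = 1%R -> wgt (x * y) = wgt x + wgt y + w (pos x) (pos y).
Proof.
rewrite /wgt /pos /sgn evM.
by case: (ev x) (ev y) => [[? ?] ?] [[? ?] ?] /= ->; rewrite mulr1z.
Qed.

Lemma wgtV x : sgn x = 1%R -> wgt x^-1 = - wgt x.
Proof.
move=> x1; have := wgtM x^-1 x1; rewrite mulgV /wgt ev1 posV //.
rewrite (additive_mapN (biadditive_r wD _)) w0 oppr0 addr0 => /eqP.
by rewrite eq_sym addrC addr_eq0 => /eqP.
Qed.

(** The weight is w(g,h) - w(h,g), which doubles because [w] is alternating. *)
Lemma commg_even x y : sgn x = 1%R -> sgn y = 1%R ->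
  ev [~ x, y] = (w (pos x) (pos y) *+ 2, 0, 1%R).
Proof.
move=> x1 y1; have wl := biadditive_l wD; have wr := biadditive_r wD.
rewrite [LHS]surjective_pairing [(ev _).1]surjective_pairing.
rewrite -/(wgt _) -/(pos _) -/(sgn _) commgEl conjgE.
have [x1' y1'] : sgn x^-1 = 1%R /\ sgn y^-1 = 1%R by rewrite !sgnV.
have posE : pos (y^-1 * (x * y)) = pos x.
  by rewrite !posM x1 y1' posV // !mulr1z addrCA addNr addr0.
congr (_, _, _); last by rewrite !sgnM x1 y1 x1' y1'.
  rewrite wgtM // posE !wgtM // posM x1 mulr1z !posV // !wgtV //.
  rewrite !(additive_mapN (wl _)) wr !w0 addr0 subr0 -(alternatingN wD w0 (pos y)).
  by rewrite (addrC (wgt x)) -!addrA !addKr -mulr2n.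
by rewrite posM posE x1' mulr1z posV // addNr.
Qed.

Lemma commg_flat x y : sgn x = 1%R -> sgn y = 1%R -> [~ x, y] \in flat.
Proof.
by move=> x1 y1; apply/flatP; rewrite /pos /sgn commg_even.
Qed.

(** The products [gen t * gen 0] have position [t] and sign 1, positions add in sign 1, and [T]
    generates [G]. The boolean form suits [xchoose]. *)
Lemma pos_surj g : exists x, (pos x == g) && (sgn x == 1%R).
Proof.
have shift x y : sgn x = 1%R -> sgn y = 1%R ->
    pos (x * y) = pos x + pos y /\ sgn (x * y) = 1%R.
  by move=> x1 y1; rewrite posM sgnM x1 y1 mulr1z.
suff [x [<- x1]] : exists x, pos x = g /\ sgn x = 1%R.
  by exists x; rewrite x1 !eqxx.
have [l [Tl ->]] := T_gen g; elim: l Tl => [|[t n] l IHl] Tl.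
  by exists 1; rewrite pos1 sgn1 big_nil.
have [|x [xE x1]] := IHl; first by move=> p pl; apply: Tl; rewrite inE pl orbT.
have {IHl Tl} Tt : T t by apply: (Tl (t, n)); rewrite mem_head.
rewrite big_cons -xE /=.
have [y [yE y1]] : exists y, pos y = t *~ n /\ sgn y = 1%R.
  have tau1 : sgn (gen t * gen 0) = 1%R by rewrite sgnM !sgn_gen.
  have tauE : pos (gen t * gen 0) = t by rewrite posM !pos_gen // mul0rz addr0.
  have nat_case m : exists y, pos y = t *+ m /\ sgn y = 1%R.
    elim: m => [|m [y [yE y1]]]; first by exists 1; rewrite pos1 sgn1.
    exists (gen t * gen 0 * y).
    by have [-> ->] := shift _ _ tau1 y1; rewrite yE tauE mulrS.
  case: n => n; first exact: nat_case.
  have [y [yE y1]] := nat_case n.+1.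
  by exists y^-1; rewrite posV // yE sgnV NegzE mulrNz.
by exists (y * x); have [-> ->] := shift _ _ y1 x1; rewrite yE.
Qed.

Definition lift g : U := xchoose (pos_surj g).

Lemma liftP g : pos (lift g) = g /\ sgn (lift g) = 1%R.
Proof. by have /andP[/eqP ? /eqP ?] := xchooseP (pos_surj g). Qed.

Lemma same_pos x y : sgn x = 1%R -> sgn y = 1%R -> pos x = pos y ->
  exists2 z, z \in flat & y = x * z.
Proof.
move=> x1 y1 xy; exists (x^-1 * y); last by rewrite mulVKg.
apply/flatP; rewrite posM sgnM sgnV x1 y1 posV // xy mulr1z.
by rewrite addNr.
Qed.

(** In sign 1, elements of equal position differ by a flat, hence central, factor, which commutators
    ignore. So commutators descend to [G]. *)
Lemma commg_pos x x' y y' : sgn x = 1%R -> sgn x' = 1%R -> sgn y = 1%R ->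
  sgn y' = 1%R -> pos x = pos x' -> pos y = pos y' -> [~ x, y] = [~ x', y'].
Proof.
move=> x1 x1' y1 y1' /(same_pos x1 x1')[z zf ->] /(same_pos y1 y1')[t tf ->].
have cl a b c : c \in flat -> [~ a * c, b] = [~ a, b].
  by move=> cf; apply: commg_centrall => u; apply: flat_central.
by rewrite cl // -invgR -[RHS]invgR cl.
Qed.

Definition comm g h : flatU :=
  in_flat (commg_flat (liftP g).2 (liftP h).2).

Lemma commE x y : sgn x = 1%R -> sgn y = 1%R -> [~ x, y] = val (comm (pos x) (pos y)).
Proof.
by move=> x1 y1; apply: commg_pos => //; have [] := liftP (pos x); have [] := liftP (pos y).
Qed.

Lemma comm_alternating : alternating comm.
Proof. by move=> g; apply: val_inj; rewrite /= commgg. Qed.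

Lemma comm_anti g h : comm h g = (- comm g h)%R.
Proof. by apply: val_inj; rewrite /= invgR. Qed.

Lemma comm_biadditive : biadditive comm.
Proof.
have commDl g g' h : comm (g + g') h = (comm g h + comm g' h)%R.
  have [g0 g1] := liftP g; have [g0' g1'] := liftP g'; have [h0 h1] := liftP h.
  have gg1 : sgn (lift g * lift g') = 1%R by rewrite sgnM g1 g1'.
  apply: val_inj; rewrite flat_valD -[RHS]/([~ lift g, lift h] * [~ lift g', lift h]).
  rewrite -commMg_central => [|u]; last exact/flat_central/commg_flat.
  by rewrite commE // posM g1 g0 g0' mulr1z h0.
split=> // x y z; rewrite comm_anti commDl opprD.
by rewrite -!comm_anti.
Qed.

(** * Products of commutators and the elements [rho g] *)

Definition commprod x := exists L : seq (G * G),
  x = val (\sum_(p <- L) comm p.1 p.2)%R.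

Lemma commprodM x y : commprod x -> commprod y -> commprod (x * y).
Proof. by move=> [L ->] [L' ->]; exists (L ++ L'); rewrite big_cat. Qed.

Lemma commprodV x : commprod x -> commprod x^-1.
Proof.
move=> [L ->]; exists [seq (p.2, p.1) | p <- L]; rewrite big_map /=.
by under [in RHS]eq_bigr do rewrite comm_anti; rewrite sumrN.
Qed.

Lemma commprod_commg x y : sgn x = 1%R -> sgn y = 1%R -> commprod [~ x, y].
Proof. by move=> x1 y1; exists [:: (pos x, pos y)]; rewrite big_seq1 commE. Qed.

Lemma commprod_central x y : commprod x -> commute x y.
Proof. by move=> [L ->]; apply: flat_central (valP _). Qed.

Lemma ev_commprod (L : seq (G * G)) :
  ev (val (\sum_(p <- L) comm p.1 p.2)%R) =
  ((\sum_(p <- L) w p.1 p.2) *+ 2, 0, 1%R).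
Proof.
elim: L => [|[g h] L IHL]; first by rewrite !big_nil mul0rn ev1.
have [[g0 g1] [h0 h1]] := (liftP g, liftP h).
rewrite !big_cons flat_valD evM IHL commg_even // g0 h0 /mulW.
by rewrite mul0rz (additive_map0 (biadditive_r wD _)) !addr0 mulrnDl.
Qed.

Lemma T2 g : T (g *+ 2).
Proof. by have := T_refl g T0; rewrite subr0. Qed.

Definition rho g : U := gen (g *+ 2) * gen 0.

Lemma sgn_rho g : sgn (rho g) = 1%R.
Proof. by rewrite sgnM !sgn_gen //; apply: T2. Qed.

Lemma ev_rho g : ev (rho g) = (0, g *+ 2, 1%R).
Proof.
rewrite evM !ev_gen //; last exact: T2.
by rewrite /genW /mulW mul0rz (additive_map0 (biadditive_r wD _)) !addr0.
Qed.

Lemma rho0 : rho 0 = 1.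
Proof. by rewrite /rho mul0rn genM. Qed.

Lemma gen_shift x t : sgn x = 1%R -> T t ->
  gen (t + pos x *+ 2) = x * gen t * x^-1.
Proof.
by move=> x1 Tt; have [_ ->] := gen_conjU x Tt; rewrite x1 mulr1z addrC.
Qed.

(** Put a = [lift g] and b = (0) a^-1 (0). Then [rho g] is a b and [rho (g + h)] is a ([rho h]) b,
    so one commutator exchanging a and [rho h] suffices. *)
Lemma rhoD g h : exists2 c, commprod c & rho (g + h) = c * (rho h * rho g).
Proof.
have [g0 g1] := liftP g; exists [~ (lift g)^-1, (rho h)^-1].
  by apply: commprod_commg; rewrite sgnV ?sgn_rho.
have rhoE k : rho (g + k) = lift g * gen (k *+ 2) * (lift g)^-1 * gen 0.
  by rewrite /rho mulrnDl addrC -{1}g0 gen_shift //; apply: T2.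
have -> : rho g = lift g * (gen 0 * (lift g)^-1 * gen 0).
  by rewrite -[in LHS](addr0 g) rhoE mul0rn !mulgA.
rewrite (mulgA (rho h)) mulgA -commgCV rhoE /rho -!mulgA.
by rewrite (mulgA (gen 0) (gen 0)) genM // mul1g.
Qed.

Lemma rhoV g : exists2 c, commprod c & (rho g)^-1 = c * rho (- g).
Proof.
have [c cc] := rhoD (- g) g; rewrite addNr rho0 => cE; exists c => //.
by apply: mulg1_eq; rewrite mulgA -(commprod_central _ cc) -mulgA.
Qed.

(** The normal form of words with even class counts; [rhoD] makes it stable under products. *)
Definition quasi x := exists2 c, commprod c & exists g, x = c * rho g.

Lemma quasiM x y : quasi x -> quasi y -> quasi (x * y).
Proof.
move=> [c cc [g ->]] [c' cc' [h ->]]; have [d dd dE] := rhoD h g.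
exists (c * c' * d^-1); first exact/commprodM/commprodV/dd/commprodM.
exists (h + g); move: (rho g) (rho h) (rho (h + g)) dE => a b _ ->.
by rewrite -!mulgA mulKg (mulgA c' a) (commprod_central a cc') -mulgA.
Qed.

(** The pair equals [tau * y * tau^-1 * (lift h)^-1], while [y * (lift h)^-1] is the inverse of
    [rho h]; exchanging [tau] and [y] costs one commutator. *)
Lemma gen_pair t h : T t -> quasi (gen t * gen (t + h *+ 2)).
Proof.
move=> Tt; have [h0 h1] := liftP h.
pose tau := gen t * gen 0; pose y := gen 0 * lift h * gen 0.
have [d dd dE] := rhoV h; exists ([~ tau^-1, y^-1] * d).
  apply: commprodM dd; apply: commprod_commg; rewrite sgnV !sgnM ?h1 !sgn_gen //.
exists (- h); rewrite -mulgA -dE.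
have -> : (rho h)^-1 = y * (lift h)^-1.
  rewrite /rho -[h *+ 2]add0r -{1}h0 gen_shift // !invgM invgK !genV //.
  by rewrite /y !mulgA.
have -> : y * (lift h)^-1 = y * tau * (tau^-1 * (lift h)^-1) by rewrite mulgA mulgK.
rewrite mulgA -commgCV -{1}h0 gen_shift // /tau /y invgM !genV // -!mulgA.
by rewrite !(mulgA (gen 0) (gen 0)) genM // !mul1g.
Qed.


(** * Classes modulo 2, and the trivial kernel under 2-independence *)

Variables (G2 TT : zmodType) (pi : G -> G2) (tens : G2 -> G2 -> TT).
Hypothesis piP : is_quotient_by_2 pi.
Hypothesis tensP : is_tensor_square tens.
Let piD : additive_map pi := quotient_additive piP.

(* Conjugation moves a letter next to an earlier one of the same class mod 2
   without changing that class, so such letters can be collected in pairs. *)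
Lemma quasi_even (ts : seq G) : {in ts, forall t, T t} ->
  (forall c, ~~ odd (count (fun t => pi t == c) ts)) -> quasi (\prod_(t <- ts) gen t).
Proof.
have [n] := ubnP (size ts); elim: n ts => // n IHn [|t ts] /=.
  move=> _ _ _; rewrite big_nil; exists 1; first by exists [::]; rewrite big_nil.
  by exists 0; rewrite rho0 mulg1.
rewrite ltnS => size_ts Tts even_ts.
have Tt : T t by apply: Tts; rewrite mem_head.
have /hasP[t' t'ts /eqP pit'] : has (fun s => pi s == pi t) ts.
  rewrite has_count; have := even_ts (pi t); rewrite eqxx oddD /= negbK.
  by case: (count _ ts).
have {}Tts : {in ts, forall s, T s} by move=> s s_ts; apply: Tts; rewrite inE s_ts orbT.
have Tt' := Tts _ t'ts.
case/splitPr: t'ts => p1 p2 in size_ts Tts even_ts *.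
rewrite big_cons big_cat big_cons /=; set P := \prod_(s <- p1) gen s.
have [Tr rE] := gen_conjU P Tt'; set r := pos P *+ 2 + _ in Tr rE.
have [h hE] : exists h, r = t + h *+ 2.
  apply/(quotient_eq piP); rewrite -pit'; apply/(quotient_eq piP).
  rewrite /r; case: (sgnP P) => ->; first by exists (pos P); rewrite mulr1z addrC.
  (* In sign -1, 2 [pos P] - t' = t' + 2 ([pos P] - t'). *)
  exists (pos P - t'); rewrite mulrN1z mulrnBl addrCA; congr (_ + _).
  by rewrite mulr2n opprD addrA subrr add0r.
have -> : gen t * (P * (gen t' * \prod_(s <- p2) gen s)) =
    gen t * gen (t + h *+ 2) * \prod_(s <- p1 ++ p2) gen s.
  by rewrite -hE -rE big_cat /= -!mulgA mulKg.
apply: quasiM; first exact: gen_pair.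
apply: IHn => [|s|c].
- by move: size_ts; rewrite !size_cat /= addnS => /ltnW.
- rewrite mem_cat => s_p; apply: Tts; rewrite mem_cat inE.
  by case/orP: s_p => ->; rewrite ?orbT.
- have := even_ts c; rewrite !count_cat /= pit'.
  by rewrite !oddD; do 3!case: (odd _); case: (pi t == c).
Qed.

Variables (I : eqType) (b : I -> G).
Hypothesis b_gen : forall g : G, exists s : seq (I * int),
  g = (\sum_(p <- s) b p.1 *~ p.2)%R.
Hypothesis b_free : forall (s : seq I) (c : I -> int), uniq s ->
  (\sum_(i <- s) b i *~ c i)%R = 0 -> forall i, i \in s -> c i = 0.
Hypothesis wP : is_exterior_square w.

(* The minors are functionals on [A], so they vanish on [sum w p.1 p.2] as soon
   as twice this sum is [0]; they also are the coordinates of any alternating sum. *)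
Lemma quasi_ev1 x : quasi x -> ev x = oneW G A -> x = 1.
Proof.
move=> [c [L ->] [g ->]]; rewrite evM ev_commprod ev_rho /mulW /oneW mulr1z.
rewrite !add0r (additive_map0 (biadditive_l wD _)) !addr0 => -[L0 g0].
(* The position 2g vanishes, so [rho g] is the square of the generator at 0. *)
rewrite /rho g0 genM // mulg1.
have [ps psE] := alternating_expand b_gen L.
rewrite (psE _ _ comm_biadditive comm_alternating) big1 // => p _.
suff -> : (\sum_(xy <- L) minor b_gen p xy.1 xy.2)%R = 0 by rewrite mulr0z.
have [_ _ /(_ _ _ (minor_biadditive b_gen b_free p) (minor_alternating b_gen p))] := wP.
move=> [[h [hD hE]] _]; have := congr1 h L0; rewrite mulr2n hD (additive_map0 hD).
have -> : h (\sum_(xy <- L) w xy.1 xy.2)%R = (\sum_(xy <- L) minor b_gen p xy.1 xy.2)%R.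
  by rewrite (additive_map_sum hD); apply: eq_bigr => xy _; rewrite hE.
by move: (\sum_(xy <- L) _)%R => m /=; lia.
Qed.

(** Under (l,g,v) -> theta l + g (x) g, the wedge term of a product cancels the cross terms of the
    square; signs disappear in exponent 2. Each generator goes to its square, and the unit to 0. *)
Lemma sum_square_ev1 (ts : seq G) : {in ts, forall t, T t} ->
  ev (\prod_(t <- ts) gen t) = oneW G A ->
  (\sum_(t <- ts) tens (pi t) (pi t))%R = 0.
Proof.
have [tD _] := tensP; have tl := biadditive_l tD; have tr := biadditive_r tD.
pose f g h := (tens (pi g) (pi h) + tens (pi h) (pi g))%R.
have fD : biadditive f.
  by split=> x y z; rewrite /f piD tl tr; rewrite addrACA.
have f0 : alternating f by move=> x; rewrite /f -mulr2n (tens_double piP tensP).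
have [_ _ /(_ _ _ fD f0)[[theta [thD thE]] _]] := wP.
have main (l : seq G) : {in l, forall t, T t} ->
    let x := \prod_(t <- l) gen t in
    (\sum_(t <- l) tens (pi t) (pi t) = theta (wgt x) + tens (pi (pos x)) (pi (pos x)))%R.
  elim: l => [|t l IHl] Tl /=.
    rewrite !big_nil /wgt ev1 pos1 (additive_map0 thD) (additive_map0 piD).
    by rewrite (additive_map0 (tl _)) addr0.
  rewrite !big_cons IHl; last by move=> s sl; apply: Tl; rewrite inE sl orbT.
  have Tt : T t by apply: Tl; rewrite mem_head.
  set x := \prod_(t <- l) gen t; rewrite /wgt posM evM ev_gen // pos_gen // sgn_gen //.
  rewrite /pos; case: (ev x) => [[a g] v] /=; rewrite mulrN1z !add0r.
  rewrite thD thE /f piD (additive_mapN piD) !tl !tr.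
  have tN (y z : G2) : (- tens y z = tens y z)%R.
    by apply/eqP; rewrite eq_sym -addr_eq0 -mulr2n (tens_double piP tensP).
  rewrite !(additive_mapN (tl _)) !(additive_mapN (tr _)) !tN.
  rewrite (addrC (tens (pi g) (pi t)) (tens (pi g) _)).
  rewrite (addrACA (tens (pi t) (pi t))) (addrACA (theta a)) -mulr2n mulrnDl.
  by rewrite !(tens_double piP tensP) !addr0 addrCA.
move=> Tts ts1; rewrite main // /wgt /pos ts1 (additive_map0 thD).
by rewrite (additive_map0 piD) (additive_map0 (tl _)) addr0.
Qed.

Lemma sgn_prod (ts : seq G) : {in ts, forall t, T t} ->
  sgn (\prod_(t <- ts) gen t) = (if odd (size ts) then -1 else 1)%R.
Proof.
elim: ts => [|t ts IHts] Tts; first by rewrite big_nil sgn1.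
rewrite big_cons sgnM sgn_gen ?IHts ?mem_head //=; first by case: (odd _).
- by move=> s s_ts; apply: Tts; rewrite inE s_ts orbT.
- by apply: Tts; rewrite mem_head.
Qed.

Lemma independent_ev1 x :
  two_independent tens (Tab_nonzero T pi) -> ev x = oneW G A -> x = 1.
Proof.
move=> indep x1; apply: quasi_ev1 (x1); have [ts Tts xE] := U_generated x.
rewrite xE in x1 *; apply: quasi_even => // c.
pose q (z : G2) := tens z z; pose zs := [seq q (pi t) | t <- ts].
have q_inj : injective q := tens_square_inj piP tensP b_gen b_free.
have zs0 : (\sum_(z <- zs) z = 0)%R by rewrite big_map; apply: sum_square_ev1.
have -> : count (fun t => pi t == c) ts = count_mem (q c) zs.
  by rewrite count_map; apply: eq_count => t /=; rewrite (inj_eq q_inj).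
(* Independence says nothing about the class 0; the sign of [x] supplies the even length that
   controls it. *)
apply: even_mult0.
  have := sgn_prod Tts; rewrite /sgn x1 /= size_map.
  by case: (odd _).
move=> z z0; apply/negP => z_odd; apply: indep.
exists [seq y <- undup zs | odd (count_mem y zs) && (y != 0)]; split.
- suff : z \in [seq y <- undup zs | odd (count_mem y zs) && (y != 0)].
    by case: filter.
  rewrite mem_filter z_odd z0 mem_undup /=.
  by apply/count_memPn => z_count; rewrite z_count in z_odd.
- by rewrite filter_uniq ?undup_uniq.
- move=> y; rewrite mem_filter mem_undup => /andP[/andP[_ y0] /mapP[t t_ts yE]].
  exists (pi t); split=> //; split; first by exists t; split=> //; apply: Tts.
  move=> pit0; move/eqP: y0; apply; rewrite yE pit0 /q.
  exact: additive_map0 (biadditive_l tensP.1 _).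
- rewrite big_filter -sum_odd_mult // => y /mapP[t _ ->].
  exact: tens_double piP tensP _ _.
Qed.


(** * Parity invariants, and a kernel element under 2-dependence *)

Definition class_count (c : G2) (u : seq (letter T)) : bool :=
  odd (count (fun l => pi (sval l.1) == c) u).

Lemma class_count_cat c u v :
  class_count c (u ++ v) = class_count c u (+) class_count c v.
Proof. by rewrite /class_count count_cat oddD. Qed.

(** In the conjugation relation the two letters [t] cancel modulo 2, and 2t - s has the class of
    s. *)
Lemma class_count_Ueq c (u v : seq (letter T)) :
  Ueq u v -> class_count c u = class_count c v.
Proof.
elim=> {u v} [//|u v _ ->//|u v y _ -> _ ->//|u u' v v' _ uu' _ vv'|y d|y|t s r rE].
- by rewrite !class_count_cat uu' vv'.
- by rewrite /class_count /= addn0; case: (_ == c).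
- by rewrite /class_count /= addn0; case: (_ == c).
have -> : [:: (t, false); (s, false); (t, true)] =
    [:: (t, false)] ++ [:: (s, false)] ++ [:: (t, true)] by [].
rewrite !class_count_cat addbCA /class_count /= addbb addbF rE.
have -> // : pi (sval t *+ 2 - sval s) = pi (sval s).
apply/(quotient_eq piP); exists (sval t - sval s); rewrite mulrnBl addrCA.
by congr (_ + _); rewrite mulr2n opprD addrA subrr add0r.
Qed.

Definition parity (c : G2) x : bool := class_count c (repr x : seq (letter T)).

Lemma parity_word c (u : word T) : parity c (Ucl u) = class_count c (u : seq (letter T)).
Proof. exact/class_count_Ueq/Ueq_repr. Qed.

Lemma parity1 c : parity c 1 = false.
Proof. exact: parity_word. Qed.

Lemma parityM c x y : parity c (x * y) = parity c x (+) parity c y.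
Proof.
have [u ->] := Ucl_surj x; have [v ->] := Ucl_surj y.
by rewrite -Ucl_cat !parity_word class_count_cat.
Qed.

Lemma parityV c x : parity c x^-1 = parity c x.
Proof.
have := parityM c x x^-1; rewrite mulgV parity1.
by case: (parity c x); case: (parity c x^-1).
Qed.

Lemma parity_gen c t : T t -> parity c (gen t) = (pi t == c).
Proof.
move=> Tt; rewrite (gen_sval (exist _ t Tt)) parity_word /class_count /=.
by rewrite addn0 oddb.
Qed.

Lemma parity_comm c (L : seq (G * G)) :
  parity c (val (\sum_(p <- L) comm p.1 p.2)%R) = false.
Proof.
elim: L => [|p L IHL]; first by rewrite big_nil parity1.
rewrite big_cons flat_valD parityM IHL addbF /= commgEl conjgE !parityM !parityV.
by do 2!case: (parity c _).
Qed.

(** The inserted generators at 0 have class 0, which differs from [c]. *)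
Lemma parity_prod_shift c (ts : seq G) : 0 <> c -> {in ts, forall t, T t} ->
  parity c (\prod_(t <- ts) (gen t * gen 0)) = odd (count (fun t => pi t == c) ts).
Proof.
move=> c0; elim: ts => [|t ts IHts] Tts; first by rewrite big_nil parity1.
rewrite big_cons parityM IHts => [|s s_ts]; last by apply: Tts; rewrite inE s_ts orbT.
rewrite parityM !parity_gen //; last by apply: Tts; rewrite mem_head.
by rewrite (additive_map0 piD) (introF eqP c0) addbF /= oddD oddb.
Qed.

Fixpoint opairs (ts : seq G) : seq (G * G) :=
  if ts is t :: ts' then [seq (t, s) | s <- ts'] ++ opairs ts' else [::].

Lemma ev_prod_shift (ts : seq G) : {in ts, forall t, T t} ->
  ev (\prod_(t <- ts) (gen t * gen 0)) =
  (\sum_(p <- opairs ts) w p.1 p.2, \sum_(t <- ts) t, 1%R)%R.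
Proof.
have wr := biadditive_r wD.
elim: ts => [|t ts IHts] Tts; first by rewrite !big_nil ev1.
have Tt : T t by apply: Tts; rewrite mem_head.
rewrite big_cons evM IHts; last by move=> s s_ts; apply: Tts; rewrite inE s_ts orbT.
have -> : ev (gen t * gen 0) = (0, t, 1%R).
  by rewrite evM !ev_gen // /genW /mulW mul0rz (additive_map0 (wr _)) !addr0.
rewrite /mulW !mulr1z mulr1 add0r big_cons /= big_cat big_map /=.
by rewrite (additive_map_sum (wr _)) addrC.
Qed.

(** Modulo 2, the minors over pairs i < j sum to the off-diagonal part of the product of the two
    coordinate sums. That product and its diagonal part both vanish. *)
Lemma minor_opairs p (ts : seq G) : (\sum_(t <- ts) t = 0)%R ->
  (\sum_(t <- ts) coord2 b_gen p.1 t * coord2 b_gen p.2 t = 0)%R ->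
  exists m, (\sum_(xy <- opairs ts) minor b_gen p xy.1 xy.2 = m *+ 2)%R.
Proof.
have cD := coord2D b_gen b_free.
move=> ts0 sq0; apply: intF2_eq0.
have main (l : seq G) :
    ((\sum_(xy <- opairs l) minor b_gen p xy.1 xy.2)%:~R =
     coord2 b_gen p.1 (\sum_(t <- l) t) * coord2 b_gen p.2 (\sum_(t <- l) t) -
     \sum_(t <- l) coord2 b_gen p.1 t * coord2 b_gen p.2 t :> 'F_2)%R.
  elim: l => [|t l IHl].
    by rewrite !big_nil (additive_map0 (cD _)) mul0r subr0.
  rewrite !big_cons /= big_cat big_map /= rmorphD /= IHl !cD.
  have -> : (\sum_(s <- l) minor b_gen p t s)%R = minor b_gen p t (\sum_(s <- l) s)%R.
    by rewrite (additive_map_sum (biadditive_r (minor_biadditive b_gen b_free p) _)).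
  rewrite /minor rmorphB !rmorphM /= -!/(coord2 b_gen _ _).
  set s := (\sum_(s <- l) s)%R; set q := (\sum_(s <- l) _)%R.
  (* A vanishing double is added to turn the minus sign of the minor into a plus. *)
  rewrite -[LHS]addr0 -(F2_double (coord2 b_gen p.2 t * coord2 b_gen p.1 s)%R).
  by rewrite mulr2n; ring.
by rewrite main ts0 sq0 !(additive_map0 (cD _)) mul0r subr0.
Qed.

Lemma opairs_half (ts : seq G) : (\sum_(t <- ts) t = 0)%R ->
  (\sum_(t <- ts) tens (pi t) (pi t) = 0)%R ->
  exists L, (\sum_(p <- opairs ts) w p.1 p.2 = (\sum_(p <- L) w p.1 p.2) *+ 2)%R.
Proof.
move=> ts0 sq0; have [ps /(_ _ _ wD w0)->] := alternating_expand b_gen (opairs ts).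
elim: ps => [|p ps [L IHps]]; first by exists [::]; rewrite !big_nil mul0rn.
have [m mE] := minor_opairs ts0 (sum_square_coord2 piP tensP b_gen b_free p.1 p.2 sq0).
(* [L] holds pairs without coefficients, so half the coefficient goes into the first entry. *)
exists ((b p.1 *~ m, b p.2) :: L); rewrite !big_cons mE IHps mulrnDl /=.
by rewrite (additive_mapMz (biadditive_l wD _)) !pmulrn -!mulrzA; congr (_ *~ _ + _)%R; lia.
Qed.

Lemma dependent_kernel : two_dependent tens (Tab_nonzero T pi) ->
  exists2 x, ev x = oneW G A & x <> 1.
Proof.
move=> [s [s_n0 s_uniq sP s0]].
have [ts [Tts ts0 tsE]] : exists ts, [/\ {in ts, forall t, T t},
    {in ts, forall t, pi t <> 0} & s = [seq tens (pi t) (pi t) | t <- ts]].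
  elim: s {s_n0 s_uniq s0} sP => [|z s IHs] sP; first by exists [::].
  have [|ts [Tts ts0 ->]] := IHs; first by move=> y ys; apply: sP; rewrite inE ys orbT.
  have [_ [[[t [Tt <-]] t0] ->]] := sP z (mem_head _ _).
  by exists (t :: ts); split=> // y; rewrite inE => /orP[/eqP->//|]; [exact: Tts|exact: ts0].
rewrite {s sP}tsE in s_n0 s_uniq s0; rewrite big_map in s0.
have [g gE] := (quotient_eq0 piP _).1 (sum_square_quotient piP tensP b_gen b_free s0).
(* The lifts sum to 2g. Adding -2g, an element of [T] of class 0, makes the sum vanish and leaves
   the sum of squares unchanged. *)
pose ts1 := - g *+ 2 :: ts.
have Tts1 : {in ts1, forall t, T t}.
  by move=> t; rewrite inE => /orP[/eqP->|/Tts //]; apply: T2.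
have pig0 : pi (- g *+ 2) = 0 by apply/(quotient_eq0 piP); exists (- g).
have sum0 : (\sum_(t <- ts1) t = 0)%R by rewrite big_cons gE mulNrn addNr.
have [||L LE] := opairs_half (ts := ts1) => //.
  by rewrite big_cons pig0 s0 addr0 (additive_map0 (biadditive_l tensP.1 _)).
(* Swapping the pairs of [L] negates their commutators, which cancels the weight of the product. *)
exists (\prod_(t <- ts1) (gen t * gen 0) *
    val (\sum_(p <- [seq (q.2, q.1) | q <- L]) comm p.1 p.2)%R).
  rewrite evM ev_commprod (ev_prod_shift Tts1) LE sum0 big_map /mulW mul0rz.
  rewrite (additive_map0 (biadditive_r wD _)) !addr0.
  under [X in (_ + X *+ 2)%R]eq_bigr do rewrite (alternatingN wD w0).
  by rewrite sumrN mulNrn subrr.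
(* The squares are distinct, so the class of the first lift occurs exactly once and has odd
   parity. *)
case: ts => [//|t ts] in s_n0 s_uniq Tts ts0 ts1 Tts1 {s0 gE sum0 LE} *.
have t0 : 0 <> pi t by move=> /esym; apply: ts0; rewrite mem_head.
move/(congr1 (parity (pi t))); rewrite parity1 parityM parity_comm addbF.
rewrite parity_prod_shift // /ts1 /= pig0 eqxx (introF eqP t0) add0n.
move: s_uniq => /= /andP[t_notin _]; rewrite (_ : count _ ts = 0%N) //.
apply/eqP; rewrite -leqn0 leqNgt -has_count; apply: contra t_notin.
by move=> /hasP[r r_ts /eqP piE]; apply/mapP; exists r; rewrite ?piE.
Qed.

End Structure.

(** * Bijectivity of U -> W against 2-independence *)

Theorem theorem5p1 (G : zmodType) (T : G -> Prop)
  (A : zmodType) (wedge : G -> G -> A)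
  (G2 : zmodType) (pi : G -> G2)
  (TT : zmodType) (tens : G2 -> G2 -> TT) :
  is_free_abelian G ->
  generates T ->
  T 0 ->
  (forall g t, T t -> T (g *+ 2 - t)) ->
  is_exterior_square wedge ->
  is_quotient_by_2 pi ->
  is_tensor_square tens ->
  (U_to_W_iso wedge T <-> two_independent tens (Tab_nonzero T pi)).
Proof.
move=> [I [b [b_gen b_free]]] T_gen T0 T_refl wP piP tensP.
have [wD w0 _] := wP; split=> [[_ inj] dep|indep].
  have [x x1] := dependent_kernel wD w0 T0 T_refl T_gen piP tensP b_gen b_free dep.
  have [u xE] := Ucl_surj x; rewrite xE in x1 *.
  by apply; apply/UclP/inj; rewrite -(ev_word wD w0) x1.
split=> [x|u v uv]; first exact: inW_evalW.
(* Surjectivity holds in general; injectivity is reduced to the kernel through the quotient of the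
   two words. *)
apply/UclP/divg1_eq.
apply: (independent_ev1 wD w0 T0 T_refl T_gen piP tensP b_gen b_free wP) => //.
rewrite (evM wD w0) (ev_word wD w0 u) uv -(ev_word wD w0 v) -(evM wD w0).
by rewrite mulgV (ev1 T wD w0).
Qed.
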